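(* Let $q \ge 2$ be a prime power, let $p \in (0,1]$, let $b \ge 1$ be an integer and let $c \ge 1$ be a real number. With high probability, the random matroid $\mathrm{PG}_p(n-1,q)$ is not $(b,c)$-decomposable; that is, $\lim_{n\to\infty} \mathbb{P}\left(\mathrm{PG}_p(n-1,q) \text{ is } (b,c)\text{-decomposable}\right) = 0$, where $q,p,b,c$ are fixed as $n \to \infty$.
   Context: $\mathrm{PG}(n-1,q)$ denotes the rank-$n$ projective geometry over the finite field $\mathrm{GF}(q)$, regarded as a matroid: its ground set consists of the $\frac{q^n-1}{q-1}$ one-dimensional subspaces (points) of $\mathrm{GF}(q)^n$, and a set of points is independent if nonzero vectors representing its elements are linearly independent over $\mathrm{GF}(q)$. Let $E_p$ be the random subset of the points of $\mathrm{PG}(n-1,q)$ obtained by retaining each point independently with probability $p$; then $\mathrm{PG}_p(n-1,q)$ is the restriction $\mathrm{PG}(n-1,q)|E_p$. A matroid is $k$-colourable if its ground set can be partitioned into $k$ (possibly empty) independent sets. The colouring number $\mathrm{col}(M)$ is the smallest $k$ such that $M$ is $k$-colourable. A subset $Y$ of the ground set of $M$ is called $b$-colourable if the restriction $M|Y$ is $b$-colourable. A matroid $M$ with ground set $E$ and colouring number $k = \mathrm{col}(M)$ is $(b,c)$-decomposable if there is a partition $E = E_1 \cup E_2 \cup \cdots \cup E_\ell$ into nonempty classes (for some number $\ell$) such that (i) $|E_i| \le ck$ for all $i \in \{1,\dots,\ell\}$, and (ii) every transversal $Y = \{y_1,\dots,y_\ell\}$ with $y_i \in E_i$ for all $i$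 is $b$-colourable. A sequence of events $\mathcal{E}_n$ occurs with high probability if $\lim_{n\to\infty}\mathbb{P}(\mathcal{E}_n) = 1$. *)

(* Defs.v *)
From HB Require Import structures.
From mathcomp Require Import all_boot all_order all_algebra.

Set Implicit Arguments.
Unset Strict Implicit.
Unset Printing Implicit Defensive.

Import Order.TTheory GRing.Theory Num.Theory.

Local Open Scope ring_scope.

Record matroid (T : finType) := Matroid {
  ground : {set T};
  indep : pred {set T};
  indep_ground : forall X, indep X -> X \subset ground;
  indep0 : indep set0;
  indepS : forall X Y : {set T}, X \subset Y -> indep Y -> indep X;
  indep_aug : forall X Y : {set T}, indep X -> indep Y -> (#|X| < #|Y|)%N ->
    exists2 y, y \in Y :\: X & indep (y |: X)
}.

Section Restriction.
Variables (T : finType) (M : matroid T) (A : {set T}).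

Definition restrict_ground := ground M :&: A.
Definition restrict_indep : pred {set T} :=
  fun X => (X \subset A) && indep M X.

Fact restrict_indep_ground X : restrict_indep X -> X \subset restrict_ground.
Proof. by case/andP=> XA /indep_ground XG; rewrite subsetI XG. Qed.

Fact restrict_indep0 : restrict_indep set0.
Proof. by rewrite /restrict_indep sub0set indep0. Qed.

Fact restrict_indepS (X Y : {set T}) : X \subset Y -> restrict_indep Y -> restrict_indep X.
Proof.
move=> XY /andP[YA iY].
by rewrite /restrict_indep (subset_trans XY YA) (indepS XY iY).
Qed.

Fact restrict_indep_aug (X Y : {set T}) :
  restrict_indep X -> restrict_indep Y -> (#|X| < #|Y|)%N ->
  exists2 y, y \in Y :\: X & restrict_indep (y |: X).
Proof.
case/andP=> XA iX /andP[YA iY] /(indep_aug iX iY)[y yYX iyX].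
exists y => //; rewrite /restrict_indep iyX andbT subUset XA andbT sub1set.
by move: yYX; rewrite inE => /andP[_ /(subsetP YA)].
Qed.

Definition restrict : matroid T :=
  Matroid restrict_indep_ground restrict_indep0 restrict_indepS
          restrict_indep_aug.
End Restriction.

(* The classes C i may be empty, so they do not form a finset [partition]. *)
Definition colourable (T : finType) (M : matroid T) (k : nat) : bool :=
  [exists C : {ffun 'I_k -> {set T}},
    [&& [forall i, indep M (C i)],
        [forall i, forall j, (i != j) ==> [disjoint C i & C j]]
      & \bigcup_i C i == ground M]].

(* If M is k-colourable for some k (i.e. if M has no loop), this is the least
   such k (see [colourable_col] and [col_min]); otherwise it is
   #|ground M|.+1. *)
Definition col (T : finType) (M : matroid T) : nat :=
  find (colourable M) (iota 0 #|ground M|.+1).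

Definition loopless (T : finType) (M : matroid T) : bool :=
  [forall x in ground M, indep M [set x]].

Lemma loopless_colourable (T : finType) (M : matroid T) :
  loopless M -> colourable M #|ground M|.
Proof.
move=> /forall_inP iM; apply/existsP.
exists [ffun i => [set enum_val i]]; apply/and3P; split.
- by apply/forallP=> i; rewrite ffunE iM // enum_valP.
- apply/forallP=> i; apply/forallP=> j; apply/implyP=> ij.
  by rewrite !ffunE disjoints1 inE (inj_eq enum_val_inj).
- apply/eqP/setP=> x; apply/bigcupP/idP => [[i _]|xG].
    by rewrite ffunE inE => /eqP->; apply: enum_valP.
  by exists (enum_rank_in xG x) => //; rewrite ffunE inE enum_rankK_in.
Qed.

Lemma colourable_col (T : finType) (M : matroid T) :
  loopless M -> colourable M (col M).
Proof.
move=> /loopless_colourable cM.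
have hM : has (colourable M) (iota 0 #|ground M|.+1).
  by apply/hasP; exists #|ground M| => //; rewrite mem_iota add0n leqnn.
have := nth_find 0%N hM; rewrite nth_iota //.
by move: hM; rewrite has_find size_iota.
Qed.

Lemma col_min (T : finType) (M : matroid T) (k : nat) :
  colourable M k -> (col M <= k)%N.
Proof.
move=> ck; rewrite leqNgt; apply/negP=> kc.
have kG : (k < #|ground M|.+1)%N.
  apply: leq_trans kc _; rewrite -[leqRHS](size_iota 0 #|ground M|.+1).
  exact: find_size.
by have := before_find 0%N kc; rewrite nth_iota // add0n ck.
Qed.

Definition decomposable (R : numDomainType) (T : finType)
    (b : nat) (c : R) (M : matroid T) : bool :=
  [exists P : {set {set T}},
    [&& partition P (ground M),
        [forall B in P, #|B|%:R <= c * (col M)%:R]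
      & [forall Y : {set T},
          is_transversal Y P (ground M) ==> colourable (restrict M Y) b]]].

Import VectorInternalTheory.

HB.instance Definition _ (F : finFieldType) (vT : vectType F) :=
  [Countable of {vspace vT} by <:].
HB.instance Definition _ (F : finFieldType) (vT : vectType F) :=
  [Finite of {vspace vT} by <:].

Section ProjectiveGeometry.
Variables (n : nat) (F : finFieldType).
Implicit Types X Y : {set {vspace 'rV[F]_n}}.

Definition PG_points : {set {vspace 'rV[F]_n}} := [set U | \dim U == 1%N].

(* [vpick U] is a nonzero vector of U; the choice is immaterial since U is a
   line. *)
Definition PG_indep : pred {set {vspace 'rV[F]_n}} :=
  fun X => (X \subset PG_points) && free [seq vpick U | U <- enum X].

Fact PG_indep_ground X : PG_indep X -> X \subset PG_points.
Proof. by case/andP. Qed.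

Fact PG_indep0 : PG_indep set0.
Proof. by rewrite /PG_indep sub0set enum_set0 nil_free. Qed.

Fact PG_indepS X Y : X \subset Y -> PG_indep Y -> PG_indep X.
Proof.
move=> XY /andP[YP fY]; rewrite /PG_indep (subset_trans XY YP) /=.
have eX : perm_eq (enum Y) (enum X ++ enum (Y :\: X)).
  apply: uniq_perm; first exact: enum_uniq.
    rewrite cat_uniq !enum_uniq andbT /=; apply/hasPn=> U.
    by rewrite !mem_enum inE => /andP[].
  move=> U; rewrite mem_cat !mem_enum inE.
  by case: (boolP (U \in X)) => [/(subsetP XY)->|].
move: fY; rewrite (perm_free (perm_map _ eX)) map_cat.
exact: catl_free.
Qed.

Fact PG_indep_aug X Y : PG_indep X -> PG_indep Y -> (#|X| < #|Y|)%N ->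
  exists2 y, y \in Y :\: X & PG_indep (y |: X).
Proof.
case/andP=> XP fX /andP[YP fY] ltXY.
set sX := [seq vpick U | U <- enum X] in fX *.
case: (boolP [exists y in Y, vpick y \notin <<sX>>%VS]) => [|noy].
  case/exists_inP=> y yY yX; have yNX : y \notin X.
    by apply: contra yX => yX; apply/memv_span/map_f; rewrite mem_enum.
  exists y; first by rewrite inE yNX.
  rewrite /PG_indep subUset sub1set (subsetP YP) //= XP /=.
  have e : perm_eq (enum (y |: X)) (y :: enum X).
    apply: uniq_perm; rewrite /= ?enum_uniq ?mem_enum ?yNX // => U.
    by rewrite mem_enum in_cons !inE mem_enum.
  by rewrite (perm_free (perm_map _ e)) /= free_cons yX.
have sYX : (<<[seq vpick U | U <- enum Y]>> <= <<sX>>)%VS.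
  apply/span_subvP=> v /mapP[U]; rewrite mem_enum => UY ->.
  apply: contraR noy => UX; apply/exists_inP; exists U => //.
have := dimvS sYX; rewrite (eqnP fX) (eqnP fY) !size_map -!cardE.
by rewrite leqNgt ltXY.
Qed.

(* PG n F is PG(n-1, q), of rank n, for q = #|F|. *)
Definition PG : matroid {vspace 'rV[F]_n} :=
  Matroid PG_indep_ground PG_indep0 PG_indepS PG_indep_aug.

Lemma PG_loopless (A : {set {vspace 'rV[F]_n}}) : loopless (restrict PG A).
Proof.
apply/forall_inP=> U /setIP[UP UA].
rewrite /= /restrict_indep /= /PG_indep !sub1set UA UP enum_set1 /= seq1_free.
by rewrite vpick0 -dimv_eq0; move: UP; rewrite inE => /eqP->.
Qed.
End ProjectiveGeometry.

Section RandomSubset.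
Variables (R : comPzRingType) (T : finType) (p : R) (E : {set T}).

(* The probability that A holds of the random subset of E that retains each
   element independently with probability p. *)
Definition Pr_subset (A : pred {set T}) : R :=
  \sum_(X in powerset E | A X) \prod_(x in E) (if x \in X then p else 1 - p).

Lemma Pr_subset_total : Pr_subset predT = 1.
Proof.
pose F x := if x \in E then p else 0.
pose G x := if x \in E then 1 - p else 1.
have <- : \prod_x (F x + G x) = 1.
  apply: big1 => x _; rewrite /F /G.
  by case: ifP => _; [rewrite addrC subrK | rewrite add0r].
rewrite bigA_distr [RHS](bigID (fun X : {set T} => X \subset E)) /=.
rewrite [X in _ = _ + X]big1 => [|X /subsetPn[x xX xE]]; last first.
  by rewrite (bigD1 x) //= xX /F (negPf xE) mul0r.
rewrite addr0; apply: eq_big => [X|X]; first by rewrite powersetE andbT.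
rewrite powersetE andbT => XE.
rewrite [RHS](bigID (mem E)) /= [X in _ = _ * X]big1 => [|x xE].
  by rewrite mulr1; apply: eq_bigr => x xE; rewrite /F /G xE.
by rewrite /G (negPf xE) (contraNF (subsetP XE x) xE).
Qed.
End RandomSubset.

(* Main.v *)
(* Write q = |F|. The points of PG(n-1, q) have a partition into O(q^n / n)
   independent sets, obtained by removing maximal independent sets greedily, so
   every class of a decomposition has O(q^n / n) points. The s.+1-dimensional
   span of the image of a uniformly random affine map y |-> v + y A from F^s to
   F^n meets at most b * s.+1 classes, since a transversal meeting all of them is
   b-colourable. On the other hand the images of distinct y are pairwise
   independent and uniform, so two of them lie over the same class with
   probability O(1 / n), and a second moment bound shows that an expected
   proportion of the q^s images proportional to |X| / q^n hits distinct classes.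
   For s large and then n large this forces |X| < N / S for any fixed S, where
   N is the number of points; a Chernoff bound makes this exponentially
   unlikely. *)
Require Import Defs.
From HB Require Import structures.
From mathcomp Require Import all_boot all_order all_algebra finfield.
From mathcomp Require Import reals topology normedtype sequences.
From mathcomp Require Import zify ring lra.

Import Order.TTheory GRing.Theory Num.Theory.
Import numFieldNormedType.Exports.

Local Open Scope classical_set_scope.
Local Open Scope ring_scope.

(** * Second moment bound for pairwise independent uniform samples, in counting form *)

Section PairwiseUniform.
Local Open Scope nat_scope.

Lemma sum_mem {I T : finType} (f : I -> T) (K : {set T}) :
  \sum_i (f i \in K : nat) = \sum_(u in K) #|[set i | f i == u]|.
Proof.
under [RHS]eq_bigr do rewrite -sum1dep_card big_mkcond /=.
rewrite exchange_big; apply: eq_bigr => i _.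
have [fK|fK] := boolP (f i \in K).
  rewrite (bigD1 (f i)) //= eqxx big1 // => u /andP[_ /negPf uf].
  by rewrite eq_sym uf.
by rewrite big1 // => u uK; case: eqP => // e; rewrite e uK in fK.
Qed.

(** [W] is the sample space: for uniform [w], the hypotheses make the values [f w y] uniform on [V]
    and pairwise independent. *)
Variables (W Y V I : finType) (f : W -> Y -> V) (P : {set I}) (K : I -> {set V}).
Hypothesis f_unif : forall y u, #|[set w | f w y == u]| * #|V| = #|W|.
Hypothesis f_unif2 : forall y y' u u', y != y' ->
  #|[set w | (f w y == u) && (f w y' == u')]| * #|V| ^ 2 = #|W|.

Let Z w i := \sum_y (f w y \in K i : nat).

Lemma first_moment i : (\sum_w Z w i) * #|V| = #|Y| * #|K i| * #|W|.
Proof.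
rewrite /Z exchange_big big_distrl /=.
under eq_bigr => y _.
  rewrite sum_mem big_distrl /=.
  under eq_bigr do rewrite f_unif.
  rewrite sum_nat_const; over.
by rewrite sum_nat_const mulnA.
Qed.

(** The diagonal pairs of samples give the first moment; each of the at most [#|Y| ^ 2] other pairs
    lands in [K i] twice with probability [(#|K i| / #|V|) ^ 2]. *)
Lemma second_moment i :
  (\sum_w Z w i ^ 2) * #|V| ^ 2 <=
  (#|Y| * #|K i| * #|V| + #|Y| ^ 2 * #|K i| ^ 2) * #|W|.
Proof.
have Z2 w : Z w i ^ 2 = \sum_y \sum_y' ((f w y \in K i) && (f w y' \in K i) : nat).
  rewrite expnS expn1 {1}/Z big_distrl /=; apply: eq_bigr => y _.
  by rewrite /Z big_distrr /=; apply: eq_bigr => y' _; rewrite mulnb.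
under eq_bigr do rewrite Z2.
rewrite exchange_big big_distrl /=.
have -> : (#|Y| * #|K i| * #|V| + #|Y| ^ 2 * #|K i| ^ 2) * #|W| =
   \sum_(y : Y) (#|K i| * #|W| * #|V| + \sum_(y' : Y) #|K i| ^ 2 * #|W|).
  rewrite sum_nat_const sum_nat_const; ring.
apply: leq_sum => y _.
rewrite exchange_big (bigD1 y) //= mulnDl; apply: leq_add.
  under eq_bigr do rewrite andbb.
  rewrite sum_mem expnS expn1 mulnA leq_mul2r; apply/orP; right.
  rewrite big_distrl /= -sum_nat_const; apply: leq_sum => u _.
  by rewrite f_unif.
rewrite big_distrl [X in _ <= X](bigD1 y) //=; apply: leq_trans (leq_addl _ _).
apply: leq_sum => y' y'y.
have e w : ((f w y \in K i) && (f w y' \in K i)) = ((f w y, f w y') \in setX (K i) (K i)).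
  by rewrite in_setX.
under eq_bigr do rewrite e.
rewrite (sum_mem (fun w => (f w y, f w y'))) big_distrl /= -(mulnn #|K i|) -cardsX -sum_nat_const.
apply: leq_sum => -[u u'] _; rewrite -(f_unif2 y y' u u') 1?eq_sym //.
Qed.

Lemma pairwise_uniform_hits (D H : nat) : 0 < #|W| ->
  (forall i, i \in P -> #|K i| <= D) ->
  (forall w, #|[set i in P | [exists y, f w y \in K i]]| <= H) ->
  #|Y| * (\sum_(i in P) #|K i|) * #|V| <=
    H * #|V| ^ 2 + #|Y| ^ 2 * D * \sum_(i in P) #|K i|.
Proof.
move=> W0 KD hH; set k := \sum_(i in P) _.
(* 2 z <= [z > 0] + z^2, summed over the classes and over w. *)
have Z1 w i : 2 * Z w i <= [exists y, f w y \in K i] + Z w i ^ 2.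
  have [_|/existsPn n0] := boolP [exists y, f w y \in K i]; first by rewrite /=; nia.
  by rewrite /Z big1 // => y _; rewrite (negPf (n0 y)).
have S1 : 2 * \sum_(i in P) \sum_w Z w i <=
    H * #|W| + \sum_(i in P) \sum_w Z w i ^ 2.
  rewrite [X in 2 * X]exchange_big [X in _ + X]exchange_big /= big_distrr /= mulnC -sum_nat_const -big_split /=.
  apply: leq_sum => w _; rewrite big_distrr /=.
  apply: leq_trans (leq_add (hH w) (leqnn _)).
  rewrite -sum1dep_card big_mkcondr /= -big_split /=; apply: leq_sum => i _.
  by apply: leq_trans (Z1 w i) _; case: ifP.
have E1 : (\sum_(i in P) \sum_w Z w i) * #|V| = #|Y| * k * #|W|.
  rewrite big_distrl /= /k big_distrr /= big_distrl /=.
  by apply: eq_bigr => i _; rewrite first_moment.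
have E2 : (\sum_(i in P) \sum_w Z w i ^ 2) * #|V| ^ 2 <=
    (#|Y| * k * #|V| + #|Y| ^ 2 * D * k) * #|W|.
  rewrite big_distrl /= /k big_distrr /= big_distrl /= big_distrr /= -big_split /= big_distrl /=.
  apply: leq_sum => i iP; apply: leq_trans (second_moment i) _.
  rewrite leq_mul2r leq_add2l -mulnA leq_mul2l expnS expn1 leq_mul2r KD //.
  by rewrite !orbT.
(* The diagonal part of the second moment cancels one of the two copies of the first moment in
   [S1]. *)
rewrite -(leq_pmul2r W0).
have := leq_mul S1 (leqnn (#|V| ^ 2)); move: E1 E2.
set a := \sum_(i in P) _; set a2 := \sum_(i in P) _; nia.
Qed.

End PairwiseUniform.

(** * Random affine maps and the pairwise independence of their values *)

Section AffineMap.
Local Open Scope nat_scope.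
Variables (F : finFieldType) (s n : nat).

Definition affine_map (w : 'rV[F]_n * 'M[F]_(s, n)) (y : 'rV[F]_s) : 'rV[F]_n :=
  (w.1 + y *m w.2)%R.

Lemma affine_map_uniform y u :
  #|[set w | affine_map w y == u]| * #|{: 'rV[F]_n}| = #|{: 'rV[F]_n * 'M[F]_(s, n)}|.
Proof.
have -> : [set w | affine_map w y == u] =
    [set ((u - y *m A)%R, A) | A in [set: 'M[F]_(s, n)]].
  apply/setP=> -[v A]; rewrite inE /affine_map /=; apply/eqP/imsetP => [<-|[B _ [-> ->]]].
    by exists A; rewrite ?inE // addrK.
  by rewrite subrK.
rewrite card_imset => [|A B [_ ->] //].
by rewrite cardsT card_prod mulnC.
Qed.

(** All fibres of [A |-> z *m A] are translates of one another: [B] is a right inverse of this map,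
    so adding [B (x - u)] carries the fibre over [u] onto that over [x]. *)
Lemma card_mulmx_fibre (z : 'rV[F]_s) (u : 'rV[F]_n) : z != 0%R ->
  #|[set A : 'M[F]_(s, n) | z *m A == u]| * #|{: 'rV[F]_n}| = #|{: 'M[F]_(s, n)}|.
Proof.
move=> z0.
have [j zj] : exists j, z ord0 j != 0%R.
  apply/existsP; apply: contraR z0 => /existsPn z0; apply/eqP/rowP=> j.
  by rewrite mxE; apply/eqP; rewrite -[_ == _]negbK z0.
pose B (x : 'rV[F]_n) : 'M[F]_(s, n) := (((z ord0 j)^-1 *: delta_mx j ord0) *m x)%R.
have zB x : (z *m B x)%R = x.
  rewrite /B mulmxA -scalemxAr -colE; apply/rowP=> i.
  by rewrite !mxE big_ord1 !mxE mulVf // mul1r.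
have fibre x : #|[set A : 'M[F]_(s, n) | (z *m A)%R == x]| =
               #|[set A : 'M[F]_(s, n) | (z *m A)%R == u]|.
  rewrite -[RHS](card_imset _ (addrI (B (x - u)%R))).
  apply: eq_card => A; rewrite inE; apply/eqP/imsetP => [zA|[C]].
    exists (A - B (x - u)%R)%R; last by rewrite addrC subrK.
    by rewrite inE mulmxBr zA zB subKr.
  by rewrite inE => /eqP zC ->; rewrite mulmxDr zC zB subrK.
rewrite mulnC -sum_nat_const -[RHS]sum1_card.
rewrite [RHS](partition_big (mulmx z) predT) //=.
by apply: eq_bigr => x _; rewrite sum1dep_card fibre.
Qed.

(** Subtracting the two equations leaves [(y' - y) *m A = u' - u], a fibre of known size; each such
    [A] determines the translation part. *)
Lemma affine_map_uniform2 y y' u u' : y != y' ->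
  #|[set w | (affine_map w y == u) && (affine_map w y' == u')]| *
     #|{: 'rV[F]_n}| ^ 2 = #|{: 'rV[F]_n * 'M[F]_(s, n)}|.
Proof.
move=> yy'.
have -> : [set w | (affine_map w y == u) && (affine_map w y' == u')] =
    [set ((u - y *m A)%R, A) | A in [set A | (y' - y)%R *m A == (u' - u)%R]%R].
  apply/setP=> -[v A]; rewrite inE /affine_map /=.
  apply/andP/imsetP => [[/eqP <- /eqP <-]|[B]].
    exists A; last by rewrite addrK.
    by rewrite inE mulmxBl opprD addrACA subrr add0r.
  rewrite inE => /eqP e [-> ->]; rewrite subrK eqxx; split => //.
  by rewrite -addrA [(- _ + _)%R]addrC -mulmxBl e addrC subrK.
rewrite card_imset => [|A B [_ ->] //].
rewrite expnS expn1 mulnA card_mulmx_fibre ?subr_eq0 1?eq_sym //.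
by rewrite card_prod mulnC.
Qed.

End AffineMap.

(** * Points, vectors above them, and colourings of sets of points *)

Section Points.
Local Set Implicit Arguments.
Local Unset Strict Implicit.
Local Open Scope nat_scope.
Variables (n : nat) (F : finFieldType).
Implicit Types (B X Y : {set {vspace 'rV[F]_n}}) (U W : {vspace 'rV[F]_n}).

Lemma vline_pick U : U \in PG_points n F -> <[vpick U]>%VS = U.
Proof.
rewrite inE => dU; apply/eqP; rewrite eqEdim -memvE memv_pick (eqP dU) dim_vline.
by rewrite vpick0 -dimv_eq0 (eqP dU).
Qed.

Lemma vpick_inj B : B \subset PG_points n F ->
  {in B &, injective (@vpick F 'rV[F]_n)}.
Proof.
move=> /subsetP BP U U' /BP UP /BP UP' e.
by rewrite -(vline_pick UP) e vline_pick.
Qed.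

(** For a set [B] of points, these are the nonzero vectors on its lines; counting them replaces
    points by vectors, where affine maps are uniform. *)
Definition cone B : {set 'rV[F]_n} := [set v : 'rV[F]_n | <[v]>%VS \in B].

Lemma leq_card_cone B : B \subset PG_points n F -> #|B| <= #|cone B|.
Proof.
move=> BP.
rewrite -(card_in_imset (vpick_inj BP)); apply: subset_leq_card.
by apply/subsetP=> _ /imsetP[U UB ->]; rewrite inE vline_pick ?(subsetP BP).
Qed.

Lemma card_cone_leq B : B \subset PG_points n F -> #|cone B| <= #|F| * #|B|.
Proof.
move=> BP; rewrite -sum1_card.
rewrite (partition_big (fun v : 'rV[F]_n => <[v]>%VS) (mem B)) => [|v] /=; last by rewrite inE.
rewrite mulnC -sum_nat_const; apply: leq_sum => U UB.
have <- : #|U| = #|F|.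
  rewrite card_vspace; move/(subsetP BP): UB; rewrite inE => /eqP->; exact: expn1.
rewrite sum1dep_card; apply: subset_leq_card.
by apply/subsetP=> v; rewrite inE => /andP[_ /eqP <-]; exact: memv_line.
Qed.

(** Every nonzero vector lies over a point, and at most [#|F|] lie over each; the 1 lost for the
    zero vector disappears on dividing by [#|F| > 1]. *)
Lemma card_PG_points_geq : 0 < n -> #|F| ^ n.-1 <= #|PG_points n F|.
Proof.
move=> n0.
have q1 : 1 < #|F| by exact: finNzRing_gt1.
have : #|F| ^ n <= #|F| * #|PG_points n F| + 1.
  rewrite -[n in _ ^ n]mul1n -card_mx -cardsT (cardsD1 0%R) inE addnC leq_add2r.
  apply: leq_trans (card_cone_leq (subxx _)); apply: subset_leq_card.
  by apply/subsetP=> v; rewrite !inE andbT dim_vline => ->.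
rewrite -{1}(prednK n0) expnS.
set a := _ ^ n.-1; set N := #|PG_points _ _|; nia.
Qed.

Lemma PG_indep_card X W : PG_indep X -> {in X, forall U, (U <= W)%VS} ->
  #|X| <= \dim W.
Proof.
move=> /andP[_ /eqnP fX] XW; rewrite cardE -(size_map (@vpick _ _)) -fX dimvS //.
apply/span_subvP=> _ /mapP[U UX ->]; rewrite mem_enum in UX.
exact: (subvP (XW U UX)) (memv_pick U).
Qed.

Lemma colourable_card b X W : colourable (restrict (PG n F) X) b ->
  #|[set U in PG_points n F :&: X | (U <= W)%VS]| <= b * \dim W.
Proof.
case/existsP=> C /and3P[/forallP Ci _ /eqP CX].
rewrite -[PG_points n F :&: X]CX.
pose D i := [set U in C i | (U <= W)%VS].
apply: (@leq_trans #|\bigcup_i D i|).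
  apply: subset_leq_card; apply/subsetP=> U; rewrite inE => /andP[/bigcupP[i _ Ui] UW].
  by apply/bigcupP; exists i => //; rewrite inE Ui.
apply: (@leq_trans (\sum_i #|D i|)).
  elim/big_ind2: _ => [|A1 m1 A2 m2 h1 h2|//]; first by rewrite cards0.
  exact: leq_trans (leq_card_setU _ _) (leq_add h1 h2).
rewrite -[b in b * _]card_ord -sum_nat_const; apply: leq_sum => i _.
apply: PG_indep_card => [|U]; last by rewrite inE => /andP[].
have /andP[_] := Ci i; apply: PG_indepS.
by apply/subsetP=> U; rewrite inE => /andP[].
Qed.

(** A maximal independent [J] spans all of [X], and a span of dimension at most [m] has too few
    vectors to represent the points of [X]. *)
Lemma indep_subset_geq X m : X \subset PG_points n F -> #|F| ^ m < #|X| ->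
  exists2 J : {set {vspace 'rV[F]_n}}, J \subset X & PG_indep J && (m < #|J|).
Proof.
move=> XP mX; pose Q := [pred J : {set {vspace 'rV[F]_n}} | (J \subset X) && PG_indep J].
have Q0 : Q set0 by rewrite /Q /= sub0set PG_indep0.
have [J /maxsetP[/andP[JX iJ] Jmax] _] := maxset_exists Q0.
exists J; rewrite // iJ ltnNge /=; apply/negP=> Jm.
pose W := <<[seq vpick U | U <- enum J]>>%VS.
have XW U : U \in X -> vpick U \in W.
  move=> UX; have [UJ|UJ] := boolP (U \in J); first by rewrite memv_span ?map_f ?mem_enum.
  apply/negPn/negP=> UW; suff QU : Q (U |: J) by rewrite -(Jmax _ QU (subsetUr _ _)) setU11 in UJ.
  rewrite /Q /= subUset sub1set UX JX /PG_indep subUset sub1set (subsetP XP) //=.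
  rewrite (subset_trans JX XP) /=.
  have e : perm_eq (enum (U |: J)) (U :: enum J).
    apply: uniq_perm; rewrite /= ?enum_uniq ?mem_enum ?UJ // => U'.
    by rewrite mem_enum in_cons !inE mem_enum.
  by rewrite (perm_free (perm_map _ e)) /= free_cons UW; case/andP: iJ.
move: mX; rewrite ltnNge -(card_in_imset (vpick_inj XP)) => /negP; apply.
apply: (@leq_trans #|W|).
  by apply: subset_leq_card; apply/subsetP=> _ /imsetP[U /XW UX ->].
rewrite card_vspace leq_exp2l ?finNzRing_gt1 //.
by apply: leq_trans (dim_span _) _; rewrite size_map -cardE.
Qed.

(** Independent sets of more than [m] points are removed while more than [#|F| ^ m] points remain;
    the leftover points get one colour each, at cost [m] apiece. *)
Lemma PG_colourable m X : X \subset PG_points n F ->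
  exists2 k, colourable (restrict (PG n F) X) k & k * m <= #|X| + m * #|F| ^ m.
Proof.
have [k] := ubnP #|X|; elim: k X => // k IH X; rewrite ltnS => Xk XP.
have gX : ground (restrict (PG n F) X) = X by apply/setIidPr.
have [Xm|mX] := leqP #|X| (#|F| ^ m).
  exists #|X|; first by have := loopless_colourable (PG_loopless X); rewrite gX.
  by rewrite mulnC (leq_trans _ (leq_addl _ _)) // leq_mul2l Xm orbT.
have [J JX /andP[iJ mJ]] := indep_subset_geq XP mX.
have cX : #|X| = #|J| + #|X :\: J| by rewrite -(cardsID J X) (setIidPr JX).
have [||l /existsP[C /and3P[/forallP Ci /forallP Cd /eqP CX]] lm] := IH (X :\: J).
- by lia.
- exact: subset_trans (subsetDl _ _) XP.
exists l.+1; last by rewrite mulSn; lia.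
have Csub i : C i \subset X :\: J.
  by have /andP[] := Ci i.
(* [J] becomes colour 0 and the colours of [X :\: J] are shifted up by one. *)
apply/existsP; exists [ffun i => if unlift ord0 i is Some j then C j else J].
apply/and3P; split.
- apply/forallP=> i; rewrite ffunE; case: unliftP => [j _|_]; last by rewrite /= /restrict_indep JX.
  have /andP[CX' iC] := Ci j; rewrite /= /restrict_indep iC andbT.
  exact: subset_trans CX' (subsetDl _ _).
- have dJ j : [disjoint C j & J].
    rewrite disjoints_subset (subset_trans (Csub j)) //.
    by rewrite -disjoints_subset disjoint_sym disjoints_subset setCD subsetUr.
  apply/forallP=> i; apply/forallP=> i'; apply/implyP; rewrite !ffunE.
  case: unliftP => [j ->|->]; case: unliftP => [j' ->|->]; rewrite ?eqxx //.
    by rewrite (inj_eq lift_inj) => jj'; have /forallP/(_ j')/implyP := Cd j; apply.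
  by rewrite disjoint_sym.
- rewrite big_ord_recl ffunE unlift_none.
  under eq_bigr do rewrite ffunE liftK.
  rewrite CX gX /= /restrict_ground /=.
  rewrite (setIidPr (subset_trans (subsetDl _ _) XP)).
  by rewrite -{1}(setIidPr JX) setID.
Qed.

(** With [m = n./2], both [#|X|] and [m * #|F| ^ m] are at most [#|F| ^ n]. *)
Lemma col_PG_leq X : X \subset PG_points n F ->
  Defs.col (restrict (PG n F) X) * n./2 <= 2 * #|F| ^ n.
Proof.
move=> XP; have [k /col_min colk km] := PG_colourable n./2 XP.
apply: leq_trans (leq_mul colk (leqnn _)) (leq_trans km _).
have q1 : 1 < #|F| by exact: finNzRing_gt1.
rewrite mul2n -addnn; apply: leq_add.
  apply: leq_trans (leq_card_cone XP) (leq_trans (max_card _) _).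
  by rewrite card_mx mul1n.
apply: (@leq_trans (#|F| ^ n./2 * #|F| ^ n./2)).
  by rewrite leq_mul2r ltnW ?orbT // ltn_expl.
rewrite -expnD leq_exp2l // addnn -{2}(odd_double_half n); exact: leq_addl.
Qed.
End Points.

(** * Transversals of partitions *)

Section Partitions.
Local Set Implicit Arguments.
Local Unset Strict Implicit.
Local Open Scope nat_scope.

Lemma exists_transversal {T : finType} (P : {set {set T}}) (D : {set T}) (Q : pred T) :
  partition P D -> exists2 Y : {set T}, is_transversal Y P D &
    #|[set B in P | [exists x in B, Q x]]| <= #|[set x in Y | Q x]|.
Proof.
move=> pP; have /and3P[/eqP cP tP P0] := pP.
(* The representative of a class satisfies [Q] whenever some element of the class does. *)
pose g (B : {set T}) := if [pick x in B | Q x] is Some x then Some x else [pick x in B].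
have gB B x : g B = Some x -> x \in B.
  rewrite /g; case: pickP => [y /andP[yB _] [<-] //|_].
  by case: pickP => // y yB [<-].
have gE B : B \in P -> exists x, g B = Some x.
  move=> BP; rewrite /g; case: pickP => [y _|_]; first by exists y.
  case: pickP => [y _|B0]; first by exists y.
  by case/negP: P0; rewrite (_ : set0 = B) //; apply/setP=> x; rewrite inE B0.
pose Y := [set x | [exists B in P, g B == Some x]].
exists Y.
  apply/and3P; split=> //.
    apply/subsetP=> x; rewrite inE => /exists_inP[B BP /eqP /gB xB].
    by rewrite -cP; apply/bigcupP; exists B.
  apply/forall_inP=> B BP; have [x gx] := gE B BP.
  apply/cards1P; exists x; apply/setP=> y; rewrite !inE.
  apply/andP/eqP => [[/exists_inP[B' B'P /eqP gy] yB]|->].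
    move: gy (gB _ _ gy) => gy yB'.
    move: gy; rewrite -(def_pblock tP B'P yB') (def_pblock tP BP yB) gx.
    by case.
  by split; [apply/exists_inP; exists B; rewrite ?gx | exact: gB gx].
apply: leq_trans (leq_imset_card (pblock P) _); apply: subset_leq_card.
apply/subsetP=> B; rewrite inE => /andP[BP /exists_inP[y yB Qy]].
have [x gx] := gE B BP; apply/imsetP; exists x; last first.
  by rewrite (def_pblock tP BP) // (gB _ _ gx).
rewrite !inE; apply/andP; split; first by apply/exists_inP; exists B; rewrite ?gx.
move: gx; rewrite /g; case: pickP => [z /andP[_ Qz] [<-] //|/(_ y)].
by rewrite yB Qy.
Qed.

Lemma colourable_restrict2 {T : finType} (M : matroid T) (X Y : {set T}) b :
  Y \subset X -> colourable (restrict (restrict M X) Y) b ->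
  colourable (restrict M Y) b.
Proof.
move=> YX /existsP[C /and3P[/forallP Ci Cd CX]].
apply/existsP; exists C; apply/and3P; split=> //.
  by apply/forallP=> i; have /and3P[CY _ iC] := Ci i; rewrite /= /restrict_indep CY.
by rewrite (eqP CX) /= /restrict_ground /= /restrict_ground -setIA (setIidPr YX).
Qed.

End Partitions.

(** * Classes of a decomposition met by subspaces and by affine images *)

Section Decompositions.
Local Set Implicit Arguments.
Local Unset Strict Implicit.
Local Open Scope nat_scope.
Variables (n : nat) (F : finFieldType).
Variables (X : {set {vspace 'rV[F]_n}}) (P : {set {set {vspace 'rV[F]_n}}}) (b : nat).
Hypothesis XP : X \subset PG_points n F.
Hypothesis partP : partition P X.
Hypothesis transP : forall Y : {set {vspace 'rV[F]_n}}, is_transversal Y P X ->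
  colourable (restrict (restrict (PG n F) X) Y) b.

(** A transversal that picks a point in [W] wherever possible has at most [\dim W] points of [W] in
    each of its [b] colours. *)
Lemma subspace_hits (W : {vspace 'rV[F]_n}) :
  #|[set B in P | [exists U in B, (U <= W)%VS]]| <= b * \dim W.
Proof.
have [Y tY] := exists_transversal (fun U => (U <= W)%VS) partP.
move/leq_trans; apply; have /and3P[_ YX _] := tY.
have := colourable_card W (colourable_restrict2 YX (transP tY)).
by rewrite (setIidPr (subset_trans YX XP)).
Qed.

Lemma affine_map_hits s (w : 'rV[F]_n * 'M[F]_(s, n)) :
  #|[set B in P | [exists y, affine_map F s n w y \in cone B]]| <= b * s.+1.
Proof.
(* The image of the affine map lies in the span of its translation vector and the [s] rows of its
   matrix. *)
pose W := <<w.1 :: [seq row i w.2 | i <- enum 'I_s]>>%VS.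
have dW : \dim W <= s.+1.
  by apply: leq_trans (dim_span _) _; rewrite /= size_map size_enum_ord.
apply: leq_trans (leq_trans (subspace_hits W) _); last by rewrite leq_mul2l dW orbT.
apply: subset_leq_card; apply/subsetP=> B; rewrite !inE => /andP[-> /existsP[y]].
rewrite inE => yB; apply/exists_inP; exists <[affine_map F s n w y]>%VS => //.
rewrite -memvE /affine_map mulmx_sum_row; apply: memvD; first by rewrite memv_span ?mem_head.
apply: rpred_sum => i _; apply: memvZ; apply: memv_span.
by rewrite in_cons; apply/orP; right; apply/mapP; exists i; rewrite ?mem_enum.
Qed.

Lemma partition_second_moment s D : (forall B, B \in P -> #|B| <= D) ->
  exists2 k, #|X| <= k &
    #|F| ^ s * k * #|F| ^ n <=
      b * s.+1 * (#|F| ^ n) ^ 2 + (#|F| ^ s) ^ 2 * (#|F| * D) * k.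
Proof.
move=> BD; have BP B : B \in P -> B \subset PG_points n F.
  move=> BP; apply: subset_trans XP; rewrite -(cover_partition partP).
  exact: bigcup_sup.
exists (\sum_(B in P) #|cone B|).
  rewrite (card_partition partP); apply: leq_sum => B /BP; exact: leq_card_cone.
have := pairwise_uniform_hits _ _ _ _ (affine_map F s n) P (@cone n F)
  (affine_map_uniform F s n) (affine_map_uniform2 F s n) (#|F| * D) (b * s.+1).
rewrite !card_mx !mul1n; apply => [|B PB|w]; last exact: affine_map_hits.
- by rewrite card_prod !card_mx -expnD expn_gt0 ltnW // finNzRing_gt1.
- by apply: leq_trans (card_cone_leq (BP B PB)) _; rewrite leq_mul2l BD ?orbT.
Qed.

End Decompositions.

Lemma exists_large_expn (q K : nat) : (1 < q)%N -> exists s, (K * s.+1 < q ^ s)%N.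
Proof.
(* Here [q ^ (4 * K)] is the square of [q ^ (2 * K) >= 2 * K + 1], and
   [(2 * K + 1) ^ 2 > K * (4 * K + 1)]. *)
move=> q1; exists (2 * K).*2.
apply: (@leq_trans ((2 * K).+1 ^ 2)); first by nia.
rewrite -muln2 expnM leq_exp2r //; exact: ltn_expl.
Qed.

(** * Decomposable restrictions are sparse *)

Lemma PG_decomposable_sparse (R : realType) (F : finFieldType) (b S : nat) (c : R) :
  0 <= c -> \forall n \near \oo, forall X : {set {vspace 'rV[F]_n}},
    X \subset PG_points n F -> decomposable b c (restrict (PG n F) X) ->
    (#|X| * S < #|PG_points n F|)%N.
Proof.
move=> c0; have q1 : (1 < #|F|)%N by exact: finNzRing_gt1.
have [s sK] := exists_large_expn #|F| (2 * b * #|F| * S) q1.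
pose c' := Num.Def.archi_bound c.
(* The threshold gives [h4], by which the collision term is at most half of the main term. *)
exists (8 * (#|F| ^ s * #|F| * c') + 2)%N => // n /= nb X XP.
case/existsP=> P /and3P[]; rewrite (_ : ground _ = X); last by apply/setIidPr.
move=> pP /forall_inP PB /forallP PY.
rewrite ltnNge; apply/negP => NX.
pose k := Defs.col (restrict (PG n F) X).
have BD B : B \in P -> (#|B| <= c' * k)%N.
  move=> /PB Bk; rewrite -(@ler_nat R) natrM; apply: le_trans Bk _.
  by rewrite ler_wpM2r // ltW // archi_boundP.
have [|kap Xkap main] := partition_second_moment XP pP (b := b) _ s BD.
  by move=> Y tY; exact: (implyP (PY Y)).
have n0 : (0 < n)%N by lia.
have kh : (k * n./2 <= 2 * #|F| ^ n)%N := col_PG_leq XP.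
have N0 := card_PG_points_geq F n0.
have V0 : (0 < #|F| ^ n)%N by rewrite expn_gt0 ltnW.
have Vk : (#|F| ^ n <= #|F| * S * kap)%N.
  rewrite -(prednK n0) expnS -mulnA leq_mul2l; apply/orP; right.
  apply: leq_trans N0 (leq_trans NX _).
  by rewrite mulnC leq_mul2l Xkap orbT.
have h4 : (4 * (#|F| ^ s * #|F| * c') < n./2)%N.
  move: nb; set z := (_ * c')%N; rewrite -divn2; lia.
move: kh Vk h4 main sK V0.
set V := (#|F| ^ n)%N; set m := (#|F| ^ s)%N; set q := #|F|; set h := n./2.
move=> kh Vk h4 main sK V0.
(* Multiplying by [h] allows [kh] to replace the colouring number by [2 * V / h]. *)
have main_h : (m * kap * V * h <= b * s.+1 * V ^ 2 * h + 2 * m * (m * q * c') * kap * V)%N.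
  apply: leq_trans (leq_mul main (leqnn h)) _.
  have := leq_mul (leqnn (m ^ 2 * q * c' * kap)%N) kh; nia.
have half : (4 * m * (m * q * c') * kap * V <= m * kap * V * h)%N.
  have := leq_mul (leqnn (m * kap * V)%N) (ltnW h4); nia.
have : (m * kap * (V * h) <= 2 * (b * s.+1 * V) * (V * h))%N by nia.
rewrite leq_pmul2r; last by rewrite muln_gt0 V0; lia.
move=> mk.
have : (m * V <= 2 * b * q * S * s.+1 * V)%N.
  apply: leq_trans (leq_mul (leqnn m) Vk) _.
  have := leq_mul (leqnn (q * S)%N) mk; nia.
by rewrite leq_pmul2r // leqNgt sK.
Qed.

(** * Lower tail of the size of a random subset *)

Section Chernoff.
Local Set Implicit Arguments.
Local Unset Strict Implicit.
Variables (R : realFieldType) (T : finType) (p : R) (E : {set T}).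
Hypotheses (p_ge0 : 0 <= p) (p_le1 : p <= 1).

Lemma Pr_subset_weight_ge0 (X : {set T}) :
  0 <= \prod_(x in E) (if x \in X then p else 1 - p).
Proof. by apply: prodr_ge0 => x _; case: ifP; rewrite ?subr_ge0. Qed.

Lemma Pr_subset_ge0 (A : pred {set T}) : 0 <= Pr_subset p E A.
Proof. by apply: sumr_ge0 => X _; exact: Pr_subset_weight_ge0. Qed.

Lemma le_Pr_subset (A B : pred {set T}) :
  (forall X : {set T}, X \subset E -> A X -> B X) -> Pr_subset p E A <= Pr_subset p E B.
Proof.
move=> AB; rewrite /Pr_subset big_mkcondr [leRHS]big_mkcondr /=.
apply: ler_sum => X; rewrite powersetE => XE.
case: ifP => [/(AB X XE) -> //|_]; case: ifP => _ //; exact: Pr_subset_weight_ge0.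
Qed.

(** Dividing by [(u + v) ^+ #|E|] turns the summands into the probabilities for retention rate
    [u / (u + v)], which sum to 1. *)
Lemma sum_powerset_prod (u v : R) : u + v != 0 ->
  \sum_(X in powerset E) \prod_(x in E) (if x \in X then u else v) = (u + v) ^+ #|E|.
Proof.
move=> uv0; rewrite -[RHS]mulr1.
rewrite -[X in _ = _ * X](Pr_subset_total (u / (u + v)) E) /Pr_subset big_distrr /=.
apply: eq_big => X; first by rewrite andbT.
move=> _; rewrite -prodr_const -big_split /=; apply: eq_bigr => x _.
by case: ifP => _; field.
Qed.

(** Markov's inequality for [t ^+ (S * #|X|)], which is at least [t ^+ #|E|] on the event and has
    mean [(p * t ^+ S + (1 - p)) ^+ #|E|]. *)
Lemma Pr_subset_card_lt (t : R) (S : nat) : 0 < t -> t <= 1 ->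
  Pr_subset p E (fun X => (#|X| * S < #|E|)%N) <=
    ((p * t ^+ S + (1 - p)) / t) ^+ #|E|.
Proof.
move=> t0 t1; rewrite expr_div_n ler_pdivlMr ?exprn_gt0 //.
have p0 : p * t ^+ S + (1 - p) != 0.
  have tS : 0 < t ^+ S by exact: exprn_gt0.
  by apply: lt0r_neq0; move: p_ge0 p_le1; set u := t ^+ S in tS *; nra.
rewrite -sum_powerset_prod // mulr_suml big_mkcondr /=.
apply: ler_sum => X; rewrite powersetE => XE.
have -> : \prod_(x in E) (if x \in X then p * t ^+ S else 1 - p) =
   (\prod_(x in E) (if x \in X then p else 1 - p)) * t ^+ (S * #|X|).
  have -> : t ^+ (S * #|X|) = \prod_(x in E) (if x \in X then t ^+ S else 1).
    rewrite exprM -prodr_const -big_mkcondr; apply: eq_bigl => x.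
    by case: (boolP (x \in X)) => [/(subsetP XE) ->|_]; rewrite ?andbF.
  rewrite -big_split /=; apply: eq_bigr => x _.
  by case: ifP => _ //; rewrite mulr1.
case: ifP => [XS|_]; last by rewrite mulr_ge0 ?exprn_ge0 ?Pr_subset_weight_ge0 ?ltW.
rewrite ler_wpM2l ?Pr_subset_weight_ge0 // ler_wiXn2l //; first exact: ltW.
by rewrite mulnC ltnW.
Qed.

End Chernoff.

(** Take [t = 1 - 1 / S] with [S > 2 / p]: since [t ^+ S <= 1 / 2], the numerator is at most
    [1 - p / 2 < t]. *)
Lemma exists_Chernoff_rate {R : realType} {p : R} : 0 < p -> p <= 1 ->
  exists S : nat, exists2 t : R, 0 < t <= 1 & 0 <= (p * t ^+ S + (1 - p)) / t < 1.
Proof.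
move=> p0 p1; pose S := (Num.Def.archi_bound (2 / p)).+2.
have Sp : 2 < p * S%:R.
  rewrite mulrC -ltr_pdivrMr // (lt_trans (Num.Theory.archi_boundP _)) ?divr_ge0 ?ltW //.
  by rewrite ltr_nat /S.
have S1 : 1 < S%:R :> R by rewrite ltr1n.
have S0 : 0 < S%:R :> R by lra.
pose x : R := S%:R^-1.
have xS : x * S%:R = 1 by rewrite mulVf ?lt0r_neq0.
have x0 : 0 < x by rewrite invr_gt0.
have x1 : x < 1 by rewrite invf_lt1.
exists S, (1 - x); first by apply/andP; split; lra.
have t0 : 0 < 1 - x by lra.
(* (1 - x)^S (1 + x)^S <= 1 and Bernoulli's (1 + x)^S >= 1 + S x = 2. *)
have tS : (1 - x) ^+ S <= 1 / 2.
  have bern : 2 <= (1 + x) ^+ S.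
    have : forall k, 1 + k%:R * x <= (1 + x) ^+ k.
      elim=> [|k IH]; first by rewrite expr0 mul0r addr0.
      rewrite exprS -natr1; have : 0 <= k%:R :> R by [].
      by set y := (1 + x) ^+ k in IH *; nra.
    by move/(_ S); rewrite mulrC xS.
  have prod1 : (1 - x) ^+ S * (1 + x) ^+ S <= 1.
    by rewrite -exprMn exprn_ile1 //; nra.
  have := exprn_ge0 S (ltW t0).
  set a := _ ^+ S in prod1 *; set d := _ ^+ S in bern prod1; nra.
have a0 := exprn_ge0 S (ltW t0).
apply/andP; split.
  apply: divr_ge0; last exact: ltW.
  by apply: addr_ge0; rewrite ?subr_ge0 // mulr_ge0 // ltW.
rewrite ltr_pdivrMr // mul1r.
by set a := _ ^+ S in tS a0 *; nra.
Qed.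

Theorem theorem4 (R : realType) (F : finFieldType) (p : R) (b : nat) (c : R)
    (p_gt0 : 0 < p) (p_le1 : p <= 1) (b_ge1 : (1 <= b)%N) (c_ge1 : 1 <= c) :
  Pr_subset p (PG_points n F)
    (fun X => decomposable b c (restrict (PG n F) X)) @[n --> \oo] --> (0 : R).
Proof.
have [S [t /andP[t0 t1] /andP[]]] := exists_Chernoff_rate p_gt0 p_le1.
set rho := (_ / t) => rho0 rho1; have p_ge0 := ltW p_gt0.
apply: (@squeeze_cvgr _ _ _ _ (fun=> 0) (fun n => rho ^+ n)); last 2 first.
- exact: cvg_cst.
- by apply: cvg_expr; rewrite ger0_norm.
near=> n; apply/andP; split; first exact: Pr_subset_ge0.
(* The Chernoff bound is [rho] to the number of points; since this number is at least [n], the bound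
   is at most [rho ^+ n]. *)
have N (n0 : (0 < n)%N) : (n <= #|PG_points n F|)%N.
  apply: leq_trans (card_PG_points_geq F n0).
  by rewrite -[n in leqLHS](prednK n0) ltn_expl // finNzRing_gt1.
have chern := Pr_subset_card_lt (PG_points n F) p_ge0 p_le1 S t0 t1.
apply: le_trans (le_trans chern _).
  apply: le_Pr_subset => // X XP; move: X XP.
  near: n; apply: PG_decomposable_sparse; exact: le_trans ler01 c_ge1.
apply: ler_wiXn2l => //; first exact: ltW.
by apply: N; near: n; exact: nbhs_infty_gt.
Unshelve. all: by end_near.
Qed.
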